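(* Let $d\ge 1$, let $X\in\mathbb{R}^d$ and $S\in[0,1]$ be jointly distributed random variables, let $\sigma>0$, and let $X^\sigma = X+\sigma Z$ with $Z\sim\mathcal N(0,I)$ independent of $(X,S)$. Let $(X_i^\sigma,S_i)_{i=1}^n$ be $n$ i.i.d. samples of $(X^\sigma,S)$, let $\mathcal H\subseteq\{f:\mathbb R^d\to[0,1]\}$ be a class of (Borel measurable) functions, and let $\delta\in(0,1)$. Let $\epsilon_C := \mathrm{MSE}_{\mathrm{train}}(h^*_{\mathcal H})-\mathrm{MMSE}^{\mathcal H}(S\vert X^\sigma)$. Then each of the following bounds holds with probability at least $1-\delta$: (i) $$\epsilon_C\le\sqrt{\frac{\log(1/\delta)}{2n}};$$ (ii) (for $n\ge 2$) with $W_i=(S_i-h^*_{\mathcal H}(X_i^\sigma))^2$ for $i=1,\dots,n$ and $\mathrm{Var}_n(W):=\frac{1}{n(n-1)}\sum_{1\le i<j\le n}(W_i-W_j)^2$, $$\epsilon_C\le\sqrt{\frac{2\,\mathrm{Var}_n(W)\log(2/\delta)}{n}}+\frac{7\log(2/\delta)}{3(n-1)} .$$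
   Context: $\mathrm{MMSE}^{\mathcal H}(S\vert X^\sigma)=\min_{h\in\mathcal H}\mathbb E[(S-h(X^\sigma))^2]$, and $h^*_{\mathcal H}\in\mathcal H$ denotes a (deterministic) minimizer (the minimum is assumed attained). For $h\in\mathcal H$, $\mathrm{MSE}_{\mathrm{train}}(h)=\frac1n\sum_{i=1}^n (S_i-h(X_i^\sigma))^2$. $\log$ is the natural logarithm. *)

(* Defs.v *)
From HB Require Import structures.
From mathcomp Require Export all_boot all_order all_algebra.
From mathcomp Require Export all_classical all_reals all_analysis.

Set Implicit Arguments.
Unset Strict Implicit.
Unset Printing Implicit Defensive.

Export Order.TTheory GRing.Theory Num.Theory.
Export numFieldNormedType.Exports.

Local Open Scope classical_set_scope.
Local Open Scope ring_scope.

(* R^k is k.-tuple R with its library sigma-algebra, the one generated by the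
   coordinate projections from the Borel sets of R; it is the Borel
   sigma-algebra of R^k. *)

Section Independence.
Context (dO : measure_display) (Om : measurableType dO) (R : realType).
Variable P : probability Om R.

Definition independent2 (d1 d2 : measure_display)
    (T1 : measurableType d1) (T2 : measurableType d2)
    (U : Om -> T1) (V : Om -> T2) : Prop :=
  forall (A : set T1) (B : set T2), measurable A -> measurable B ->
    P (U @^-1` A `&` V @^-1` B) = (P (U @^-1` A) * P (V @^-1` B))%E.

Definition mutually_independent (I : finType) (d1 : measure_display)
    (T1 : measurableType d1) (Y : I -> Om -> T1) : Prop :=
  forall (J : {set I}) (A : I -> set T1),
    (forall i, i \in J -> measurable (A i)) ->
    P (\bigcap_(i in [set` J]) (Y i @^-1` A i)) =
    (\prod_(i in J) P (Y i @^-1` A i))%E.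

Definition same_law (d1 : measure_display) (T1 : measurableType d1)
    (U V : Om -> T1) : Prop :=
  forall A : set T1, measurable A -> pushforward P U A = pushforward P V A.

(* Z ~ N(0, I_k). *)
Definition standard_gaussian (k : nat) (Z : Om -> k.-tuple R) : Prop :=
  mutually_independent (fun (i : 'I_k) (w : Om) => tnth (Z w) i) /\
  forall (i : 'I_k) (A : set R), measurable A ->
    pushforward P (fun w => tnth (Z w) i) A = normal_prob 0 1 A.

End Independence.

Definition noisy (R : realType) (Om : Type) (k : nat)
    (X : Om -> k.-tuple R) (sigma : R) (Z : Om -> k.-tuple R)
    (w : Om) : k.-tuple R :=
  [tuple tnth (X w) i + sigma * tnth (Z w) i | i < k].

Section Estimation.
Context (dO : measure_display) (Om : measurableType dO) (R : realType).
Variable P : probability Om R.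
Variable k : nat.
Implicit Types (X : Om -> k.-tuple R) (S : Om -> R) (h : k.-tuple R -> R)
  (H : set (k.-tuple R -> R)).

Definition sq_err X S h (w : Om) : R := (S w - h (X w)) ^+ 2.

Definition mse X S h : \bar R := ('E_P[sq_err X S h])%E.

(* [fine] is harmless: for S and the members of H with values in [0, 1], and H
   nonempty, the infimum lies in [0, 1].  It is a minimum as soon as
   [is_minimizer] has a solution. *)
Definition MMSE H X S : R := fine (ereal_inf [set mse X S h | h in H]).

Definition is_minimizer H X S h : Prop :=
  H h /\ forall g, H g -> (mse X S h <= mse X S g)%E.

Definition mse_train (n : nat) (Xs : 'I_n -> Om -> k.-tuple R)
    (Ss : 'I_n -> Om -> R) h (w : Om) : R :=
  n%:R^-1 * \sum_(i < n) sq_err (Xs i) (Ss i) h w.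

End Estimation.

Definition sample_var (R : realType) (n : nat) (W : 'I_n -> R) : R :=
  (n%:R * (n%:R - 1))^-1 *
  \sum_(i < n) \sum_(j < n | (i < j)%N) (W i - W j) ^+ 2.

(* Main.v *)
(** By minimality MMSE is the mean of W = (S - h*(X^sigma))^2, which lies in
    [0, 1], so that epsC is the deviation of an empirical mean of n independent
    copies of W from its expectation.  Part (i) is Hoeffding's inequality.

    For part (ii), following Maurer and Pontil, Bernstein's inequality gives
    epsC <= sqrt (2 V L / n) + L / (3 n) outside an event of probability
    delta / 2, where L = log (2 / delta) and V is the variance of W.  The true
    variance is then replaced by the empirical one through
    sqrt V <= sqrt Var_n + sqrt (2 L / (n - 1)), again outside an event of
    probability delta / 2.  This lower tail of Var_n does not need concentration
    of self-bounding functions: Var_n is an average over permutations of means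
    of n./2 independent variables D / 2, D = (W - W')^2, and D^2 <= D gives
      exp (- mu D / 2) <= 1 - (mu / 2 - mu^2 / 8) D,
    whose right-hand side is a polynomial in (W, W'); Jensen's inequality for
    exp then gives the sub-Gaussian bound with the required constant. *)

Require Import Defs.
From mathcomp Require Import all_boot all_order all_algebra.
From mathcomp Require Import fingroup perm.
From mathcomp Require Import all_classical all_reals all_analysis.
From mathcomp Require Import measurable_realfun ring lra.

Set Implicit Arguments.
Unset Strict Implicit.
Unset Printing Implicit Defensive.

Local Open Scope classical_set_scope.
Local Open Scope ring_scope.

(** * Bounded measurable functions and their expectation *)

(** This class is closed under sums, products and [expR], and its members are integrable under every
    probability, so integrability side conditions reduce to closure properties. *)
Definition bounded_mfun (dT : measure_display) (T : measurableType dT)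
    (R : realType) (f : T -> R) : Prop :=
  measurable_fun setT f /\ exists M : R, forall x, `|f x| <= M.

Section BoundedMfun.
Context (dT : measure_display) (T : measurableType dT) (R : realType).
Implicit Types f g : T -> R.

Lemma bounded_mfun_cst (c : R) : bounded_mfun (fun _ : T => c).
Proof. by split; [exact: measurable_cst | exists `|c|]. Qed.

Lemma bounded_mfunD f g : bounded_mfun f -> bounded_mfun g ->
  bounded_mfun (fun x => f x + g x).
Proof.
move=> [mf [M hM]] [mg [N hN]]; split; first exact: measurable_funD.
by exists (M + N) => x; rewrite (le_trans (ler_normD _ _))// lerD.
Qed.

Lemma bounded_mfunM f g : bounded_mfun f -> bounded_mfun g ->
  bounded_mfun (fun x => f x * g x).
Proof.
move=> [mf [M hM]] [mg [N hN]]; split; first exact: measurable_funM.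
by exists (M * N) => x; rewrite normrM ler_pM.
Qed.

Lemma bounded_mfunZ (c : R) f : bounded_mfun f ->
  bounded_mfun (fun x => c * f x).
Proof. by move=> hf; apply: bounded_mfunM => //; exact: bounded_mfun_cst. Qed.

Lemma eq_bounded_mfun f g : f =1 g -> bounded_mfun f -> bounded_mfun g.
Proof. by move=> /funext ->. Qed.

Lemma bounded_mfunN f : bounded_mfun f -> bounded_mfun (fun x => - f x).
Proof.
by move=> /(bounded_mfunZ (-1)); apply: eq_bounded_mfun => x; rewrite mulN1r.
Qed.

Lemma bounded_mfunB f g : bounded_mfun f -> bounded_mfun g ->
  bounded_mfun (fun x => f x - g x).
Proof. by move=> hf hg; apply: bounded_mfunD => //; exact: bounded_mfunN. Qed.

Lemma bounded_mfunX f n : bounded_mfun f -> bounded_mfun (fun x => f x ^+ n).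
Proof.
move=> hf; elim: n => [|n IH]; first exact: bounded_mfun_cst.
by apply: eq_bounded_mfun (bounded_mfunM hf IH) => x; rewrite exprS.
Qed.

Lemma bounded_mfun_sum (I : Type) (r : seq I) (Q : pred I) (F : I -> T -> R) :
  (forall i, Q i -> bounded_mfun (F i)) ->
  bounded_mfun (fun x => \sum_(i <- r | Q i) F i x).
Proof.
move=> hF; elim: r => [|i r IH].
  by apply: eq_bounded_mfun (bounded_mfun_cst _) => x; rewrite big_nil.
case: (boolP (Q i)) => [/[dup] Qi /hF Fi|/negbTE Qi].
  by apply: eq_bounded_mfun (bounded_mfunD Fi IH) => x; rewrite big_cons Qi.
by apply: eq_bounded_mfun IH => x; rewrite big_cons Qi.
Qed.

Lemma bounded_mfun_prod (I : Type) (r : seq I) (Q : pred I) (F : I -> T -> R) :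
  (forall i, Q i -> bounded_mfun (F i)) ->
  bounded_mfun (fun x => \prod_(i <- r | Q i) F i x).
Proof.
move=> hF; elim: r => [|i r IH].
  by apply: eq_bounded_mfun (bounded_mfun_cst _) => x; rewrite big_nil.
case: (boolP (Q i)) => [/[dup] Qi /hF Fi|/negbTE Qi].
  by apply: eq_bounded_mfun (bounded_mfunM Fi IH) => x; rewrite big_cons Qi.
by apply: eq_bounded_mfun IH => x; rewrite big_cons Qi.
Qed.

Lemma bounded_mfun_expR f : bounded_mfun f -> bounded_mfun (fun x => expR (f x)).
Proof.
move=> [mf [M hM]]; split.
  by apply: measurableT_comp => //; exact: measurable_expR.
exists (expR M) => x; rewrite ger0_norm ?expR_ge0// ler_expR.
by rewrite (le_trans _ (hM x))// ler_norm.
Qed.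

Lemma bounded_mfun_indic (A : set T) : measurable A ->
  bounded_mfun (fun x => \1_A x : R).
Proof.
move=> mA; split; first exact: measurable_indic.
by exists 1 => x; rewrite indicE; case: (_ \in _); rewrite ?normr1 ?normr0.
Qed.

End BoundedMfun.

Lemma bounded_mfun_comp (d1 d2 : measure_display) (T1 : measurableType d1)
    (T2 : measurableType d2) (R : realType) (f : T2 -> R) (U : T1 -> T2) :
  measurable_fun setT U -> bounded_mfun f -> bounded_mfun (fun x => f (U x)).
Proof.
move=> mU [mf [M hM]]; split; first exact: measurableT_comp.
by exists M => x.
Qed.

Section Expectation.
Context (dO : measure_display) (Om : measurableType dO) (R : realType).
Variable P : probability Om R.
Implicit Types f g : Om -> R.

Definition Ex f : R := \int[P]_w f w.

Lemma bounded_mfun_integrable f : bounded_mfun f ->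
  P.-integrable setT (EFin \o f).
Proof.
move=> [mf [M hM]]; apply: measurable_bounded_integrable => //.
  by rewrite -ge0_fin_numE// fin_num_measure.
by exists M; split; [exact: num_real|move=> x Mx y _ /=; rewrite (le_trans (hM _))// ltW].
Qed.
Hint Resolve bounded_mfun_integrable : core.

Lemma eq_Ex f g : f =1 g -> Ex f = Ex g.
Proof. by move=> fg; apply: eq_Rintegral => x _. Qed.

Lemma Ex_cst c : Ex (fun=> c) = c.
Proof. by rewrite /Ex Rintegral_cst//= probability_setT mulr1. Qed.

Lemma ExD f g : bounded_mfun f -> bounded_mfun g ->
  Ex (fun w => f w + g w) = Ex f + Ex g.
Proof. by move=> hf hg; apply: RintegralD => //; auto. Qed.

Lemma ExB f g : bounded_mfun f -> bounded_mfun g ->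
  Ex (fun w => f w - g w) = Ex f - Ex g.
Proof. by move=> hf hg; apply: RintegralB => //; auto. Qed.

Lemma ExZ c f : bounded_mfun f -> Ex (fun w => c * f w) = c * Ex f.
Proof. by move=> hf; apply: RintegralZl => //; auto. Qed.

Lemma Ex_le f g : bounded_mfun f -> bounded_mfun g ->
  (forall w, f w <= g w) -> Ex f <= Ex g.
Proof. by move=> hf hg fg; apply: le_Rintegral => //; auto. Qed.

Lemma Ex_ge0 f : (forall w, 0 <= f w) -> 0 <= Ex f.
Proof. by move=> f0; apply: Rintegral_ge0. Qed.

Lemma Ex_norm_le f (M : R) : bounded_mfun f -> (forall w, `|f w| <= M) ->
  `|Ex f| <= M.
Proof.
move=> hf fM; rewrite ler_norml -(Ex_cst M) -mulN1r -ExZ; last exact: bounded_mfun_cst.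
apply/andP; split; apply: Ex_le => //; (try exact: bounded_mfun_cst).
  by move=> w; rewrite mulN1r; move: (fM w); rewrite ler_norml => /andP[].
by move=> w; rewrite (le_trans (ler_norm _)).
Qed.

Lemma Ex_sum (I : Type) (r : seq I) (Q : pred I) (F : I -> Om -> R) :
  (forall i, Q i -> bounded_mfun (F i)) ->
  Ex (fun w => \sum_(i <- r | Q i) F i w) = \sum_(i <- r | Q i) Ex (F i).
Proof.
move=> hF; elim: r => [|i r IH].
  by under eq_Ex do rewrite big_nil; rewrite Ex_cst big_nil.
under eq_Ex do rewrite big_cons; rewrite big_cons.
case: ifPn => // Qi; rewrite ExD ?IH//; first exact: hF.
exact: bounded_mfun_sum.
Qed.

Lemma Ex_indic (A : set Om) : measurable A -> Ex (fun w => \1_A w) = fine (P A).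
Proof. by move=> mA; rewrite /Ex /Rintegral integral_indic// setIT. Qed.

Lemma fine_probK (A : set Om) : measurable A -> (fine (P A))%:E = P A.
Proof. by move=> mA; rewrite fineK// fin_num_measure. Qed.

Lemma measurable_lt_set f g : measurable_fun setT f -> measurable_fun setT g ->
  measurable [set w | f w < g w].
Proof.
move=> mf mg.
have -> : [set w | f w < g w] = (g \- f) @^-1` `]0, +oo[.
  by rewrite preimage_itvoy; apply/seteqP; split=> w /=; rewrite subr_gt0.
rewrite -[X in measurable X]setTI.
by apply: (measurable_funB mg mf) => //; exact: measurable_itv.
Qed.

(** Since [r >= 0], the indicator of [a < f] is at most [expR (r * (f - a))] pointwise; take
    expectations. *)
Lemma chernoff_bounded f (r a c : R) : bounded_mfun f -> 0 <= r ->
  Ex (fun w => expR (r * f w)) <= c ->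
  fine (P [set w | a < f w]) <= c * expR (- (r * a)).
Proof.
move=> hf r0 hc.
have mA : measurable [set w | a < f w].
  by apply: measurable_lt_set hf.1; exact: measurable_cst.
have he : bounded_mfun (fun w => expR (r * f w)).
  exact/bounded_mfun_expR/bounded_mfunZ.
rewrite -Ex_indic// (le_trans _ (ler_wpM2r (expR_ge0 _) hc))//.
rewrite [leRHS]mulrC -ExZ//; apply: Ex_le.
- exact: bounded_mfun_indic.
- exact: bounded_mfunZ.
- move=> w; rewrite -expRD indicE; case: (boolP (w \in _)) => [|_]; last exact: expR_ge0.
  rewrite inE/= => aw; rewrite -expR0 ler_expR addrC -mulrBr mulr_ge0// subr_ge0.
  exact: ltW.
Qed.

End Expectation.

(** * Independence and products *)

(** The sum counts the integers from 1 to [N] that are at most [y], which is the floor of [y]. *)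
Lemma layer_count (R : realType) (N : nat) (y : R) : 0 <= y <= N%:R ->
  `|y - \sum_(j < N) (j.+1%:R <= y)%R%:R| <= 1.
Proof.
case/andP => y0 yN.
(* The induction on [N] also needs the exact count when [y] lies beyond [N]. *)
suff [_ /(_ yN)] : (N%:R <= y -> \sum_(j < N) (j.+1%:R <= y)%R%:R = N%:R :> R) /\
    (y <= N%:R -> \sum_(j < N) (j.+1%:R <= y)%R%:R <= y
                    <= \sum_(j < N) (j.+1%:R <= y)%R%:R + 1).
  by move=> /andP[h1 h2]; rewrite ler_norml; apply/andP; split; lra.
elim: N {yN} => [|N [IH1 IH2]]; first by rewrite big_ord0; split=> // ?; lra.
rewrite big_ord_recr/=; have nE : N.+1%:R = N%:R + 1 :> R by rewrite -natr1.
have [Ny|yN] := lerP N.+1%:R y.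
  rewrite nE in Ny *; rewrite IH1; last by lra.
  by split=> [_|?]; rewrite mulr1n; lra.
split=> [?|_]; first by lra.
rewrite mulr0n addr0; have [Ny|/ltW yN'] := lerP N%:R y; last exact: IH2.
by rewrite IH1//; lra.
Qed.

Section Independence.
Context (dO : measure_display) (Om : measurableType dO) (R : realType).
Variable P : probability Om R.

(* Uniform approximation of f by the simple functions N^-1 sum_j 1_{f >= j/N}. *)
Lemma Ex_indic_to_bounded (dT : measure_display) (T : measurableType dT)
    (U V : Om -> T) (Z : Om -> R) (c : R) :
  measurable_fun setT U -> measurable_fun setT V -> bounded_mfun Z ->
  (forall A, measurable A ->
    Ex P (fun w => \1_A (U w) * Z w) = c * Ex P (fun w => \1_A (V w))) ->
  forall f : T -> R, bounded_mfun f ->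
    Ex P (fun w => f (U w) * Z w) = c * Ex P (fun w => f (V w)).
Proof.
move=> mU mV bZ hA f bf.
have [mZ [B hB]] := bZ.
have cU g : bounded_mfun g -> bounded_mfun (fun w => g (U w)).
  exact: bounded_mfun_comp.
have cV g : bounded_mfun g -> bounded_mfun (fun w => g (V w)).
  exact: bounded_mfun_comp.
have unit_case g : bounded_mfun g -> (forall t, 0 <= g t <= 1) ->
    Ex P (fun w => g (U w) * Z w) = c * Ex P (fun w => g (V w)).
  move=> bg g01; apply/eqP; rewrite -subr_eq0.
  set D := _ - _.
  (* The identity is exact for the simple function [s], the floor of [N g]. Hence [N D] only sees
     the remainder [r], which is bounded by 1, and a bound uniform in [N] forces [D = 0]. *)
  have DN (N : nat) : N%:R * `|D| <= B + `|c|.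
    pose A (j : nat) := [set t | j.+1%:R <= N%:R * g t].
    have mA j : measurable (A j).
      have -> : A j = (fun t => N%:R * g t) @^-1` `[j.+1%:R, +oo[.
        by rewrite preimage_itvcy.
      rewrite -[X in measurable X]setTI.
      by apply: (bounded_mfunZ N%:R bg).1 => //; exact: measurable_itv.
    pose s t : R := \sum_(j < N) \1_(A j) t.
    have bs : bounded_mfun s.
      by apply: bounded_mfun_sum => j _; exact: bounded_mfun_indic.
    pose r t := N%:R * g t - s t.
    have br : bounded_mfun r by apply: bounded_mfunB => //; exact: bounded_mfunZ.
    have r1 t : `|r t| <= 1.
      rewrite /r /s.
      under eq_bigr do rewrite indicE.
      rewrite (eq_bigr (fun j : 'I_N => (j.+1%:R <= N%:R * g t)%R%:R)).
        have /andP[g0 g1] := g01 t.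
        by apply: layer_count; rewrite mulr_ge0//= ler_piMr.
      by move=> j _; congr (nat_of_bool _)%:R; apply/idP/idP; rewrite in_setE.
    have bUZ h : bounded_mfun h -> bounded_mfun (fun w => h (U w) * Z w).
      by move=> bh; apply: bounded_mfunM => //; exact: cU.
    have hs : Ex P (fun w => s (U w) * Z w) = c * Ex P (fun w => s (V w)).
      rewrite Ex_sum; last by move=> j _; exact/cV/bounded_mfun_indic.
      rewrite mulr_sumr -(eq_bigr _ (fun (j : 'I_N) _ => hA _ (mA j))).
      rewrite -Ex_sum; last by move=> j _; exact/bUZ/bounded_mfun_indic.
      by apply: eq_Ex => w; rewrite mulr_suml.
    have ND : N%:R * D = Ex P (fun w => r (U w) * Z w) - c * Ex P (fun w => r (V w)).
      have -> : Ex P (fun w => r (U w) * Z w) =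
          N%:R * Ex P (fun w => g (U w) * Z w) - Ex P (fun w => s (U w) * Z w).
        rewrite -ExZ ?[bounded_mfun _]bUZ// -?ExB; try exact: bUZ.
          by apply: eq_Ex => w; rewrite /r mulrBl mulrA.
        exact/bounded_mfunZ/bUZ.
      have -> : Ex P (fun w => r (V w)) =
          N%:R * Ex P (fun w => g (V w)) - Ex P (fun w => s (V w)).
        rewrite -ExZ -?ExB; try exact: cV.
          by apply: eq_Ex => w.
        exact/bounded_mfunZ/cV.
      by rewrite hs /D; ring.
    rewrite -[N%:R in leLHS]ger0_norm// -normrM ND.
    rewrite (le_trans (ler_normB _ _))// lerD//.
      apply: Ex_norm_le => [|w]; first exact/bounded_mfunM/bZ/cU.
      by rewrite normrM -[leRHS]mul1r ler_pM.
    by rewrite normrM ler_piMr// Ex_norm_le//; exact: cV.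
  apply: contraT => D0.
  have : 0 <= (B + `|c|) / `|D|.
    by rewrite divr_ge0// (le_trans _ (DN 0%N))// mul0r.
  move=> /archi_boundP; rewrite ltr_pdivrMr ?normr_gt0// ltNge.
  by rewrite DN.
have [M0 hM0] := bf.2.
(* General [f] is an affine image of some [g] with values in [0, 1]; the [+ 1] keeps the divisor
   [2 * M] positive. *)
pose M : R := `|M0| + 1.
have M_gt0 : 0 < M by rewrite ltr_pwDr.
have hM t : `|f t| <= M.
  by rewrite (le_trans (hM0 t))// (le_trans (ler_norm _))// lerDl.
pose g t := (2 * M)^-1 * (f t + M).
have bg : bounded_mfun g.
  by apply/bounded_mfunZ/bounded_mfunD => //; exact: bounded_mfun_cst.
have fE t : f t = 2 * M * g t - M.
  by rewrite /g mulrA divff ?mul1r ?addrK// gt_eqF// mulr_gt0.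
have g01 t : 0 <= g t <= 1.
  have := hM t; rewrite ler_norml => /andP[f1 f2].
  rewrite /g mulr_ge0 ?invr_ge0 ?mulr_ge0 ?(ltW M_gt0)//=; last lra.
  by rewrite mulrC ler_pdivrMr; lra.
(* The whole space as [A] identifies [c] as the mean of [Z], which settles the constant term of the
   affine change. *)
have ZE : Ex P Z = c.
  have := hA setT measurableT.
  under eq_Ex do rewrite indicT mul1r.
  by move=> ->; under eq_Ex do rewrite indicT; rewrite Ex_cst mulr1.
have bgZ : bounded_mfun (fun w => g (U w) * Z w).
  by apply: bounded_mfunM => //; exact: cU.
have -> : Ex P (fun w => f (U w) * Z w) =
    2 * M * Ex P (fun w => g (U w) * Z w) - M * Ex P Z.
  rewrite -!ExZ// -ExB; try exact: bounded_mfunZ.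
  by apply: eq_Ex => w; rewrite fE; ring.
have -> : Ex P (fun w => f (V w)) = 2 * M * Ex P (fun w => g (V w)) - M.
  rewrite -ExZ; last exact: cV.
  rewrite -[X in _ = _ - X](Ex_cst P M) -ExB; last exact: bounded_mfun_cst.
    by apply: eq_Ex => w; rewrite fE.
  exact/bounded_mfunZ/cV.
by rewrite unit_case// ZE; ring.
Qed.

(** Factorization over the full index set is enough: [A i = setT] removes an index, so every
    subfamily is covered. *)
Definition indic_independent (I : finType) (Y : I -> Om -> R) : Prop :=
  forall A : I -> set R, (forall i, measurable (A i)) ->
    Ex P (fun w => \prod_i \1_(A i) (Y i w)) =
    \prod_i Ex P (fun w => \1_(A i) (Y i w)).

Lemma Ex_prod (I : finType) (Y : I -> Om -> R) (f : I -> R -> R) :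
  (forall i, measurable_fun setT (Y i)) -> indic_independent Y ->
  (forall i, bounded_mfun (f i)) ->
  Ex P (fun w => \prod_i f i (Y i w)) = \prod_i Ex P (fun w => f i (Y i w)).
Proof.
move=> mY iY.
(* Indicators are replaced by bounded functions one index at a time: [s] lists the indices whose
   function is arbitrary, and outside [s] it is an indicator. At each step the remaining factors
   form the weight [Z]. *)
suff main (s : seq I) : forall f : I -> R -> R,
    (forall i, bounded_mfun (f i)) ->
    (forall i, i \notin s -> exists2 A, measurable A & f i = \1_A) ->
    Ex P (fun w => \prod_i f i (Y i w)) = \prod_i Ex P (fun w => f i (Y i w)).
  by move=> bf; apply: (main (enum I)) => // i; rewrite mem_enum.
elim: s => [|i s IH] {}f bf hf.
  have /choice[A hA] : forall i, exists A, measurable A /\ f i = \1_A.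
    by move=> i; have [//|A mA fA] := hf i; exists A.
  have {hf}-> : f = fun i => \1_(A i) by apply/funext => i; rewrite (hA i).2.
  by apply: iY => i; exact: (hA i).1.
pose Z w := \prod_(j | j != i) f j (Y j w).
have bY j g : bounded_mfun g -> bounded_mfun (fun w => g (Y j w)).
  exact: bounded_mfun_comp.
have bZ : bounded_mfun Z by apply: bounded_mfun_prod => j _; exact: bY.
under eq_Ex do rewrite (bigD1 i)//=.
rewrite [RHS](bigD1 i)//= mulrC.
apply: (Ex_indic_to_bounded _ _ bZ) => // A mA.
pose f' j := if j == i then \1_A else f j.
transitivity (Ex P (fun w => \prod_j f' j (Y j w))).
  apply: eq_Ex => w; rewrite [RHS](bigD1 i)//= {1}/f' eqxx; congr (_ * _).
  by apply: eq_bigr => j /negbTE ji; rewrite /f' ji.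
rewrite IH.
- rewrite (bigD1 i)//= {1}/f' eqxx mulrC; congr (_ * _).
  by apply: eq_bigr => j /negbTE ji; rewrite /f' ji.
- by move=> j; rewrite /f'; case: eqP => // _; exact: bounded_mfun_indic.
- move=> j js; rewrite /f'; case: eqP => [_|/eqP ji]; first by exists A.
  by apply: hf; rewrite inE negb_or ji.
Qed.

End Independence.

(** * Exponential inequalities *)

Section Calculus.
Context (R : realType).
Implicit Types f df : R -> R.

(** By the mean value theorem. Applied repeatedly, it reduces an inequality to the sign of a higher
    derivative. *)
Lemma ge0_derive_ge0 f df : (forall x : R, 0 <= x -> is_derive x 1 f (df x)) ->
  f 0 = 0 -> (forall x, 0 <= x -> 0 <= df x) -> forall x, 0 <= x -> 0 <= f x.
Proof.
move=> fdf f0 df0 x; rewrite le_eqVlt => /predU1P[<-|x0]; first by rewrite f0.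
have [y yx||c cx] := @MVT R f df 0 x x0.
- by apply: fdf; move: yx; rewrite in_itv/= => /andP[/ltW].
- apply: derivable_within_continuous => y; rewrite in_itv/= => /andP[y0 _].
  by have [] := fdf y y0.
- rewrite f0 !subr0 => ->; rewrite mulr_ge0 ?(ltW x0)// df0//.
  by move: cx; rewrite in_itv/= => /andP[/ltW].
Qed.

Lemma expRN_le (x : R) : 0 <= x -> expR (- x) <= 1 - x + x ^+ 2 / 2.
Proof.
move=> x0; rewrite -subr_ge0.
pose f2 (y : R) := y - 1 + expR (- y).
pose f1 (y : R) := 1 - y + y ^+ 2 / 2 - expR (- y).
apply: (@ge0_derive_ge0 f1 f2) => //.
- move=> y _; rewrite /f1 /f2.
  by apply: is_derive_eq; rewrite /GRing.scale/=; field.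
- by rewrite /f1 oppr0 expR0; field.
- by move=> y _; rewrite /f2; have := expR_ge1Dx (- y); lra.
Qed.

(* The [1/2] Pade approximation of the exponential. *)
Lemma expR_pade_le (x : R) : 0 <= x -> (6 - 2 * x) * expR x <= 6 + 4 * x + x ^+ 2.
Proof.
move=> x0; rewrite -subr_ge0.
pose f3 (y : R) := 2 - (2 - 2 * y) * expR y.
pose f2 (y : R) := 4 + 2 * y - (4 - 2 * y) * expR y.
pose f1 (y : R) := 6 + 4 * y + y ^+ 2 - (6 - 2 * y) * expR y.
apply: (@ge0_derive_ge0 f1 f2) => //.
- move=> y _; rewrite /f1 /f2.
  by apply: is_derive_eq; rewrite /GRing.scale/=; ring.
- by rewrite /f1 expR0; ring.
apply: (@ge0_derive_ge0 f2 f3) => //.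
- move=> y _; rewrite /f2 /f3.
  by apply: is_derive_eq; rewrite /GRing.scale/=; ring.
- by rewrite /f2 expR0; ring.
move=> y _; rewrite /f3; have := expR_ge1Dx (- y); rewrite expRN => h.
have e0 := expR_gt0 y.
have := ler_wpM2r (ltW e0) h; rewrite mulVf ?gt_eqF//; lra.
Qed.

(** For [x >= 0] the Pade bound gives the coefficient [1 / (2 (1 - x / 3))], which increases with
    [x] and so is largest at [l]. For [x < 0] the coefficient [1 / 2] of [expRN_le] already
    suffices. *)
Lemma expR_bernstein_le (l x : R) : 0 <= l < 3 -> x <= l ->
  expR x <= 1 + x + x ^+ 2 / (2 * (1 - l / 3)).
Proof.
move=> /andP[l0 l3] xl.
have dl : 0 < 2 * (1 - l / 3) by lra.
have [x0|x0] := lerP 0 x.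
  have dx : 0 < 6 - 2 * x by lra.
  apply: (@le_trans _ _ (1 + x + x ^+ 2 * (3 / (6 - 2 * x)))).
    have -> : 1 + x + x ^+ 2 * (3 / (6 - 2 * x)) =
        (6 + 4 * x + x ^+ 2) / (6 - 2 * x) by field; rewrite gt_eqF.
    by rewrite ler_pdivlMr// mulrC expR_pade_le.
  rewrite lerD2l ler_wpM2l ?sqr_ge0//.
  by rewrite ler_pdivrMr// mulrC ler_pdivlMr//; lra.
have := @expRN_le (- x); rewrite opprK sqrrN => /(_ ltac:(lra)) h.
apply: (le_trans h); rewrite lerD2l ler_wpM2l ?sqr_ge0//.
by rewrite lef_pV2 ?posrE//; lra.
Qed.

(** [ln (d y)] is the log moment generating function of a Bernoulli(p) variable. Its second
    derivative is the variance of a tilted Bernoulli variable, at most [1 / 4] because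
    [4 (1 - p) e <= (1 - p + e)^2]. *)
Lemma hoeffding_two_point (p l : R) : 0 <= p <= 1 -> 0 <= l ->
  1 - p + p * expR l <= expR (l * p + l ^+ 2 / 8).
Proof.
move=> /andP[p0 p1] l0.
pose d (y : R) : R := 1 - p + p * expR y.
have d_gt0 y : 0 < d y.
  rewrite /d; have e0 := expR_gt0 y.
  have [->|pn] := eqVneq p 1; first by rewrite subrr add0r mul1r.
  have : p < 1 by rewrite lt_neqAle pn.
  by move=> p1'; apply: ltr_pwDl; [lra | rewrite mulr_ge0// ltW].
pose f1 (y : R) := y * p + y ^+ 2 / 8 - ln (d y).
pose f2 (y : R) := p + y / 4 - 1 + (1 - p) * (d y)^-1.
pose f3 (y : R) := 1 / 4 - (1 - p) * (p * expR y) / (d y) ^+ 2.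
have dd (y : R) : is_derive y 1 d (p * expR y).
  by rewrite /d; apply: is_derive_eq; rewrite /GRing.scale/=; ring.
suff : 0 <= f1 l.
  rewrite /f1 subr_ge0 -ler_expR lnK//.
  by rewrite posrE.
apply: (@ge0_derive_ge0 f1 f2 _ _ _ l l0).
- move=> y _; rewrite /f1 /f2.
  have dl : is_derive y 1 (fun z => ln (d z)) ((d y)^-1 * (p * expR y)).
    by apply: is_derive1_comp; exact: is_derive1_ln.
  apply: is_derive_eq; rewrite /GRing.scale/=.
  have := d_gt0 y; rewrite /d => dy; field; rewrite gt_eqF//.
- by rewrite /f1 /d expR0 mulr1 subrK ln1; ring.
apply: (@ge0_derive_ge0 f2 f3).
- move=> y _; rewrite /f2 /f3.
  have dv : is_derive y 1 (fun z => (d z)^-1) (- (d y) ^- 2 * (p * expR y)).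
    by apply: is_deriveV; rewrite gt_eqF.
  apply: is_derive_eq; rewrite /GRing.scale/=.
  by have := d_gt0 y; rewrite /d => dy; field; rewrite gt_eqF.
- by rewrite /f2 /d expR0 mulr1 subrK; field.
move=> y _; rewrite /f3 subr_ge0 ler_pdivrMr ?exprn_gt0//.
rewrite /d; set e := p * expR y.
by have := sqr_ge0 (1 - p - e); nra.
Qed.

(* sqrt V <= sqrt v + sqrt (2 L / N), by completing the square. *)
Lemma empirical_bernstein_width (N n V v L : R) : 0 < N -> N <= n -> 0 < V ->
  0 <= v -> 0 <= L -> V - Num.sqrt (2 * L * V / N) <= v ->
  Num.sqrt (2 * V * L / n) + L / (3 * n) <=
  Num.sqrt (2 * v * L / n) + 7 * L / (3 * N).
Proof.
move=> N0 Nn V0 v0 L0 hv.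
have n0 : 0 < n by exact: lt_le_trans Nn.
pose x := Num.sqrt V; pose y := Num.sqrt (L / (2 * N)).
pose z := Num.sqrt (2 * L / n); pose q := Num.sqrt v.
have [x0 y0 z0 q0] : [/\ 0 <= x, 0 <= y, 0 <= z & 0 <= q].
  by split; exact: sqrtr_ge0.
have x2 : x ^+ 2 = V by rewrite sqr_sqrtr// ltW.
have y2 : y ^+ 2 = L / (2 * N) by rewrite sqr_sqrtr// divr_ge0// mulr_ge0// ltW.
have z2 : z ^+ 2 = 2 * L / n by rewrite sqr_sqrtr// divr_ge0 ?(ltW n0)// mulr_ge0.
have q2 : q ^+ 2 = v by rewrite sqr_sqrtr.
have tE : Num.sqrt (2 * L * V / N) = 2 * x * y.
  rewrite -[RHS]ger0_norm ?mulr_ge0// -sqrtr_sqr; congr Num.sqrt.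
  by rewrite !exprMn x2 y2; field; rewrite gt_eqF.
have xE : Num.sqrt (2 * V * L / n) = x * z.
  rewrite -[RHS]ger0_norm ?mulr_ge0// -sqrtr_sqr; congr Num.sqrt.
  by rewrite !exprMn x2 z2; field; rewrite gt_eqF.
have qE : Num.sqrt (2 * v * L / n) = q * z.
  rewrite -[RHS]ger0_norm ?mulr_ge0// -sqrtr_sqr; congr Num.sqrt.
  by rewrite !exprMn q2 z2; field; rewrite gt_eqF.
have LnN : L / n <= L / N by rewrite ler_wpM2l// lef_pV2.
have zy : z <= 2 * y.
  rewrite -ler_sqr ?nnegrE ?mulr_ge0// exprMn z2 y2.
  have -> : 2 ^+ 2 * (L / (2 * N)) = 2 * (L / N) by field; rewrite gt_eqF.
  by rewrite -mulrA ler_pM2l.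
(* The hypothesis reads [x^2 - 2 x y <= q^2]; adding [y^2] gives
   [(x - y)^2 <= q^2 + y^2 <= (q + y)^2]. *)
have xq : x <= q + 2 * y.
  have : (x - y) ^+ 2 <= (q + y) ^+ 2.
    rewrite tE -x2 -q2 in hv; have := mulr_ge0 q0 y0; lra.
  move=> h; have [xy|/ltW xy] := lerP x y; first by lra.
  by move: h; rewrite ler_sqr ?nnegrE ?subr_ge0 ?addr_ge0//; lra.
rewrite xE qE.
have -> : L / (3 * n) = (L / n) / 3 by field; rewrite gt_eqF.
have -> : 7 * L / (3 * N) = 7 / 3 * (L / N) by field; rewrite gt_eqF.
(* The constant 7/3 arises here: [2 y z <= 4 y^2 = 2 L / N], plus [L / (3 n) <= L / (3 N)]. *)
have yy : 4 * y ^+ 2 = 2 * (L / N) by rewrite y2; field; rewrite gt_eqF.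
have h1 := ler_wpM2r z0 xq.
have h2 := ler_wpM2l y0 zy.
by rewrite expr2 in yy; lra.
Qed.

End Calculus.

(** * The sample variance as a U-statistic *)

Section SampleVariance.
Context (R : realType).

Lemma expR_tangent (c a : R) : expR c * (1 + (a - c)) <= expR a.
Proof.
rewrite -[in leRHS](subrK c a) expRD mulrC ler_wpM2r ?expR_ge0//.
exact: expR_ge1Dx.
Qed.

(** Sum the tangent bounds taken at the mean [c]; the linear terms cancel. *)
Lemma jensen_expR (I : finType) (x : I -> R) : (0 < #|I|)%N ->
  expR (#|I|%:R^-1 * \sum_i x i) <= #|I|%:R^-1 * \sum_i expR (x i).
Proof.
move=> I0; set c := _ * \sum_i x i.
have N0 : 0 < #|I|%:R :> R by rewrite ltr0n.
rewrite mulrC ler_pdivlMr//.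
apply: (@le_trans _ _ (\sum_i expR c * (1 + (x i - c)))); last first.
  by apply: ler_sum => i _; exact: expR_tangent.
rewrite -mulr_sumr big_split sumrB !sumr_const/=.
rewrite -[X in _ <= _ * (_ + (_ - X))]mulr_natr.
by rewrite {3}/c mulrAC mulVf ?gt_eqF// mul1r subrr addr0.
Qed.

(** The first transposition sends [a] to [a']; the second moves the image of [b] to [b'] and fixes
    [a']. *)
Lemma perm_mapping2 (I : finType) (a b a' b' : I) : a != b -> a' != b' ->
  exists s : {perm I}, s a = a' /\ s b = b'.
Proof.
move=> ab ab'; exists (tperm a a' * tperm (tperm a a' b) b')%g.
rewrite !permM tpermL; split; last by rewrite tpermL.
rewrite tpermD//; last by rewrite eq_sym.
by rewrite -(inj_eq (@perm_inj _ (tperm a a'))) tpermK tpermR eq_sym.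
Qed.

(** Double counting of the sum of [f (s i) (s j)] over [s], [i] and [j]. For fixed [s] it is the
    full double sum; for fixed [i != j] it does not depend on the pair, there are [n (n - 1)] such
    pairs, and the diagonal vanishes. *)
Lemma sum_perm_pair (n : nat) (f : 'I_n -> 'I_n -> R) (a b : 'I_n) :
  (forall i, f i i = 0) -> a != b ->
  n%:R * (n%:R - 1) * \sum_(s : {perm 'I_n}) f (s a) (s b) =
  n`!%:R * \sum_i \sum_j f i j.
Proof.
move=> f0 ab.
set S := \sum_(s : {perm 'I_n}) f (s a) (s b).
have SE i j : j != i -> \sum_(s : {perm 'I_n}) f (s i) (s j) = S.
  rewrite eq_sym => ij; have [p [pa pb]] := perm_mapping2 ab ij.
  rewrite /S [RHS](reindex_inj (mulgI p)).
  by apply: eq_bigr => s _; rewrite !permM pa pb.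
have -> : n`!%:R * (\sum_i \sum_j f i j) =
    \sum_(s : {perm 'I_n}) \sum_i \sum_j f (s i) (s j).
  rewrite [RHS](eq_bigr (fun=> \sum_i \sum_j f i j)).
    by rewrite sumr_const mulr_natl; congr (_ *+ _); apply: esym; exact: card_Sn.
  move=> s _; rewrite [RHS](reindex_inj (@perm_inj _ s)); apply: eq_bigr => i _.
  by rewrite [RHS](reindex_inj (@perm_inj _ s)).
rewrite exchange_big/= (eq_bigr (fun=> (n%:R - 1) * S)).
  by rewrite sumr_const card_ord -mulrA mulr_natl.
move=> i _; rewrite exchange_big/= (bigD1 i)//= [X in X + _]big1 ?add0r//.
rewrite (eq_bigr _ (SE i)) sumr_const.
rewrite -[LHS]mulr_natl; congr (_ * _).
have := cardC1 i; rewrite card_ord => ->.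
by rewrite -subn1 natrB// (leq_ltn_trans _ (ltn_ord i)).
Qed.

(* Hoeffding's representation of a U-statistic: for each permutation s, the
   inner sum runs over disjoint, hence independent, pairs. *)
Lemma sample_var_perm (n m : nat) (W : 'I_n -> R) (a b : 'I_m -> 'I_n) :
  (0 < m)%N -> (2 <= n)%N -> (forall k, a k != b k) ->
  sample_var W = #|{perm 'I_n}|%:R^-1 * \sum_(s : {perm 'I_n})
    (m%:R^-1 * \sum_(k < m) (W (s (a k)) - W (s (b k))) ^+ 2 / 2).
Proof.
move=> m0 n2 ab; rewrite card_Sn.
have fact0 : n`!%:R != 0 :> R by rewrite pnatr_eq0 -lt0n fact_gt0.
have m0' : m%:R != 0 :> R by rewrite pnatr_eq0 -lt0n.
have nn1 : n%:R * (n%:R - 1) != 0 :> R.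
  rewrite mulf_neq0// ?pnatr_eq0 -?lt0n 1?(leq_trans _ n2)//.
  by rewrite subr_eq0 pnatr_eq1; case: eqP n2 => // ->.
pose f i j := (W i - W j) ^+ 2.
have f0 i : f i i = 0 by rewrite /f subrr expr0n.
have fC i j : f i j = f j i by rewrite /f -sqrrN opprB.
(* The factor 2 between ordered and unordered pairs cancels the [/ 2] of the kernel. *)
have half : \sum_i \sum_j f i j =
    2 * \sum_(i < n) \sum_(j < n | (i < j)%N) f i j.
  have split_sum i : \sum_j f i j =
      \sum_(j < n | (i < j)%N) f i j + \sum_(j < n | (j < i)%N) f i j.
    rewrite (bigID (fun j : 'I_n => (i < j)%N))/=; congr (_ + _).
    rewrite (bigID (fun j : 'I_n => (j < i)%N))/= [X in _ + X]big1 ?addr0.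
      by apply: eq_bigl => j; case: ltngtP.
    move=> j; rewrite -!leqNgt => /andP[ji ij].
    by rewrite (_ : j = i) ?f0//; apply/val_inj/eqP; rewrite eqn_leq ji ij.
  rewrite (eq_bigr _ (fun i _ => split_sum i)) big_split/=.
  rewrite [X in _ + X](exchange_big_dep xpredT)//=.
  rewrite [X in _ + X](eq_bigr (fun i : 'I_n => \sum_(j < n | (i < j)%N) f i j)).
    by ring.
  by move=> i _; apply: eq_bigr.
have Sk k : \sum_(s : {perm 'I_n}) f (s (a k)) (s (b k)) / 2 =
    n`!%:R * sample_var W.
  rewrite -mulr_suml; have := sum_perm_pair f0 (ab k); rewrite half => h.
  apply: (mulfI nn1); rewrite mulrA h /sample_var.
  by rewrite [RHS]mulrCA mulVKf// -mulrA mulrAC divff ?pnatr_eq0// mul1r.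
rewrite -mulr_sumr exchange_big/= (eq_bigr _ (fun k _ => Sk k)).
by rewrite sumr_const card_ord -[(_ * sample_var W) *+ m]mulr_natl !mulKf.
Qed.

Lemma measurable_sample_var (dO : measure_display) (Om : measurableType dO)
    (n : nat) (Y : 'I_n -> Om -> R) :
  (forall i, measurable_fun setT (Y i)) ->
  measurable_fun setT (fun w => sample_var (Y^~ w)).
Proof.
move=> mY; apply: measurable_funM => //; apply: measurable_sum => i.
under eq_fun do rewrite -big_filter.
apply: measurable_sum => j.
by apply: measurable_funX; exact: measurable_funB.
Qed.

Lemma measurable_empirical_bound (dO : measure_display)
    (Om : measurableType dO) (n : nat) (Y : 'I_n -> Om -> R) (a b c : R) :
  (forall i, measurable_fun setT (Y i)) ->
  measurable_fun setT
    (fun w => Num.sqrt (2 * sample_var (Y^~ w) * a / b) + c).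
Proof.
move=> mY; apply: measurable_funD => //; apply: measurableT_comp.
  by apply: continuous_measurable_fun; exact: sqrt_continuous.
by do 3 apply: measurable_funM => //; exact: measurable_sample_var.
Qed.

End SampleVariance.

(** * Moment generating functions and tails *)

Section Sample.
Context (dO : measure_display) (Om : measurableType dO) (R : realType).
Variables (P : probability Om R) (n : nat).
Variables (W : Om -> R) (Y : 'I_n -> Om -> R).
Hypotheses (mW : measurable_fun setT W) (W01 : forall w, 0 <= W w <= 1).
Hypotheses (mY : forall i, measurable_fun setT (Y i))
  (Y01 : forall i w, 0 <= Y i w <= 1).
Hypothesis Y_indep : indic_independent P Y.
Hypothesis Y_law : forall (i : 'I_n) (A : set R), measurable A ->
  Ex P (fun w => \1_A (Y i w)) = Ex P (fun w => \1_A (W w)).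

Local Notation E := (Ex P).
Let p : R := E W.
Let V : R := E (fun w => (W w - p) ^+ 2).
Let mean w : R := n%:R^-1 * \sum_(i < n) Y i w.

(* Truncation to [0, 1]: it turns polynomials in Y i into bounded functions
   of Y i. *)
Let K (x : R) : R := Num.max 0 (Num.min x 1).

Let K_id x : 0 <= x <= 1 -> K x = x.
Proof. by move=> /andP[x0 x1]; rewrite /K min_l// max_r. Qed.

Let bK : bounded_mfun K.
Proof.
split; first by apply: measurable_maxr => //; apply: measurable_minr.
exists 1 => x; rewrite ger0_norm /K ?le_max ?lexx//.
by rewrite ge_max ler01 ge_min lexx orbT.
Qed.

Let KW w : K (W w) = W w. Proof. exact: K_id. Qed.
Let KY i w : K (Y i w) = Y i w. Proof. exact: K_id. Qed.

Let bW : bounded_mfun W.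
Proof. by apply: eq_bounded_mfun KW _; exact: bounded_mfun_comp. Qed.
Let bY i : bounded_mfun (Y i).
Proof. by apply: eq_bounded_mfun (KY i) _; exact: bounded_mfun_comp. Qed.

Let Ex_law i (f : R -> R) : bounded_mfun f ->
  E (fun w => f (Y i w)) = E (fun w => f (W w)).
Proof.
move=> bf; have b1 := bounded_mfun_cst Om (1 : R).
have := @Ex_indic_to_bounded _ _ _ P _ _ (Y i) W _ 1 (mY i) mW b1 _ f bf.
rewrite mul1r => <-; first by apply: eq_Ex => w; rewrite mulr1.
move=> A mA; rewrite mul1r -(Y_law i)//.
by apply: eq_Ex => w; rewrite mulr1.
Qed.

Let p01 : 0 <= p <= 1.
Proof.
rewrite /p Ex_ge0/=; last by move=> w; case/andP: (W01 w).
rewrite -(Ex_cst P 1); apply: Ex_le => //; first exact: bounded_mfun_cst.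
by move=> w; case/andP: (W01 w).
Qed.

Let bWp : bounded_mfun (fun w => W w - p).
Proof. by apply: bounded_mfunB => //; exact: bounded_mfun_cst. Qed.

Let ExWp : E (fun w => W w - p) = 0.
Proof. by rewrite ExB ?Ex_cst ?subrr//; exact: bounded_mfun_cst. Qed.

Let V01 : 0 <= V <= 1.
Proof.
rewrite /V Ex_ge0/=; last by move=> w; exact: sqr_ge0.
rewrite -(Ex_cst P 1); apply: Ex_le; try exact: bounded_mfun_cst.
  exact: bounded_mfunX.
move=> w; have /andP[w0 w1] := W01 w; have /andP[p0 p1] := p01.
nra.
Qed.

Let VE : V = E (fun w => W w ^+ 2) - p ^+ 2.
Proof.
have bW2 : bounded_mfun (fun w => W w ^+ 2) by exact: bounded_mfunX.
have -> : V = E (fun w => (W w ^+ 2 - 2 * p * W w) + p ^+ 2).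
  by apply: eq_Ex => w; ring.
rewrite ExD; [|by apply: bounded_mfunB => //; exact: bounded_mfunZ|exact: bounded_mfun_cst].
by rewrite Ex_cst ExB ?ExZ// -/p; [ring|exact: bounded_mfunZ].
Qed.

(** Factors are grouped by their index in ['I_n], so that independence of the full family applies.
    By injectivity each fibre of [e] has at most one element, and an empty fibre contributes the
    constant 1. *)
Lemma Ex_prod_inj (J : finType) (e : J -> 'I_n) (h : J -> R -> R) :
  injective e -> (forall q, bounded_mfun (h q)) ->
  E (fun w => \prod_q h q (Y (e q) w)) = \prod_q E (fun w => h q (W w)).
Proof.
move=> inj_e bh.
pose f i x := \prod_(q | e q == i) h q x.
have bf i : bounded_mfun (f i) by apply: bounded_mfun_prod.
transitivity (E (fun w => \prod_i f i (Y i w))).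
  apply: eq_Ex => w; rewrite (partition_big e xpredT)//=.
  by apply: eq_bigr => i _; apply: eq_bigr => q /eqP ->.
rewrite Ex_prod// [RHS](partition_big e xpredT)//=.
apply: eq_bigr => i _; rewrite Ex_law// /f.
have [q /eqP eq_i|no_q] := pickP (fun q => e q == i); last first.
  rewrite [RHS]big_pred0// -[RHS](Ex_cst P 1).
  by apply: eq_Ex => w; rewrite big_pred0.
have eE : (fun q' => e q' == i) =1 pred1 q.
  by move=> q'; rewrite -eq_i (inj_eq inj_e).
rewrite [RHS](big_pred1 q)//.
by apply: eq_Ex => w; rewrite (big_pred1 q).
Qed.

(** Chernoff with parameter [r n]: the exponent [r n (mean - p)] is a sum over the sample, so its
    exponential factorizes. *)
Lemma mean_upper_tail (r c t : R) : (0 < n)%N -> 0 <= r ->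
  E (fun w => expR (r * (W w - p))) <= c ->
  fine (P [set w | t < mean w - p]) <= c ^+ n * expR (- (r * n%:R * t)).
Proof.
move=> n0 r0 hc.
have n0' : n%:R != 0 :> R by rewrite pnatr_eq0 -lt0n.
have bm : bounded_mfun (fun w => mean w - p).
  apply: bounded_mfunB; last exact: bounded_mfun_cst.
  by apply: bounded_mfunZ; exact: bounded_mfun_sum.
apply: chernoff_bounded => //; first by rewrite mulr_ge0.
pose g x := expR (r * (K x - p)).
have bg : bounded_mfun g.
  apply/bounded_mfun_expR/bounded_mfunZ/bounded_mfunB => //.
  exact: bounded_mfun_cst.
have -> : E (fun w => expR (r * n%:R * (mean w - p))) =
    E (fun w => \prod_i g (Y (id i) w)).
  apply: eq_Ex => w; rewrite -expR_sum; congr expR.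
  under [RHS]eq_bigr do rewrite KY.
  rewrite -mulr_sumr sumrB sumr_const card_ord -mulrA mulrBr /mean mulVKf//.
  by rewrite mulr_natl.
rewrite (@Ex_prod_inj _ id (fun=> g))// prodr_const card_ord.
have -> : E (fun w => g (W w)) = E (fun w => expR (r * (W w - p))).
  by apply: eq_Ex => w; rewrite /g KW.
by apply: lerXn2r => //; rewrite ?nnegrE ?(le_trans _ hc) ?Ex_ge0// => w; exact: expR_ge0.
Qed.

Lemma hoeffding_mgf (r : R) : 0 <= r ->
  E (fun w => expR (r * (W w - p))) <= expR (r ^+ 2 / 8).
Proof.
move=> r0.
have bl : bounded_mfun (fun w => 1 + (expR r - 1) * W w).
  by apply: bounded_mfunD; [exact: bounded_mfun_cst | exact: bounded_mfunZ].
apply: (@le_trans _ _ (expR (- (r * p)) * E (fun w => 1 + (expR r - 1) * W w))).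
  rewrite -ExZ//; apply: Ex_le; [exact/bounded_mfun_expR/bounded_mfunZ|exact: bounded_mfunZ|].
  move=> w; rewrite mulrBr addrC expRD ler_wpM2l ?expR_ge0//.
  have /andP[w0 w1] := W01 w.
  (* Chord bound: the tangent at [r W], evaluated at 0 and at [r], is averaged with weights [1 - W]
     and [W], and the average is [expR (r * W)]. *)
  have h0 := expR_tangent (r * W w) 0; have hr := expR_tangent (r * W w) r.
  rewrite expR0 in h0.
  have := lerD (ler_wpM2l w0 hr) (ler_wpM2l (_ : 0 <= 1 - W w) h0).
  rewrite subr_ge0 => /(_ w1); rewrite mulr1.
  set a := expR (r * W w); set b := expR r.
  by lra.
rewrite ExD; [|exact: bounded_mfun_cst|exact: bounded_mfunZ].
rewrite Ex_cst ExZ// -/p.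
apply: (@le_trans _ _ (expR (- (r * p)) * expR (r * p + r ^+ 2 / 8))).
  rewrite ler_wpM2l ?expR_ge0// (le_trans _ (hoeffding_two_point p01 r0))//.
  by rewrite mulrBl mul1r mulrC; lra.
by rewrite -expRD addKr.
Qed.

(** As [r (W - p) <= r], [expR_bernstein_le] applies with [l = r]; in the mean the linear term
    vanishes and the quadratic one gives [V]. *)
Lemma bernstein_mgf (r : R) : 0 <= r < 3 ->
  E (fun w => expR (r * (W w - p))) <= expR (r ^+ 2 * V / (2 * (1 - r / 3))).
Proof.
move=> r03; have /andP[r0 r3] := r03.
set D := 2 * (1 - r / 3).
have b1 := bounded_mfun_cst Om (1 : R).
have bD : bounded_mfun (fun w => (r ^+ 2 / D) * (W w - p) ^+ 2).
  exact/bounded_mfunZ/bounded_mfunX.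
have bL : bounded_mfun (fun w => 1 + r * (W w - p)).
  by apply: bounded_mfunD => //; exact: bounded_mfunZ.
apply: (@le_trans _ _ (E (fun w => 1 + r * (W w - p) + (r ^+ 2 / D) * (W w - p) ^+ 2))).
  apply: Ex_le; [exact/bounded_mfun_expR/bounded_mfunZ|exact: bounded_mfunD|].
  move=> w; have /andP[w0 w1] := W01 w; have /andP[p0 p1] := p01.
  have := @expR_bernstein_le R r (r * (W w - p)) r03.
  rewrite exprMn mulrAC; apply.
  by rewrite -[leRHS]mulr1 ler_wpM2l//; lra.
rewrite ExD// ExD//; last exact: bounded_mfunZ.
rewrite Ex_cst ExZ// ExWp mulr0 addr0 ExZ; last exact: bounded_mfunX.
by rewrite -/V mulrAC; exact: expR_ge1Dx.
Qed.

(** The pairs are disjoint, hence independent, and the squared difference of two independent copies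
    of [W] has mean [2 V]. *)
Lemma Ex_prod_pairs (m : nat) (e : 'I_m * bool -> 'I_n) (c : R) : injective e ->
  E (fun w => \prod_(k < m) (1 - c * (Y (e (k, false)) w - Y (e (k, true)) w) ^+ 2)) =
  (1 - c * (2 * V)) ^+ m.
Proof.
move=> inj_e.
(* The factor is a sum of three products of a function of the first variable
   and a function of the second. *)
pose u (b : bool) (t : 'I_3) (x : R) : R :=
  if b then K x ^+ t
  else if val t is 0%N then 1 - c * K x ^+ 2
  else if val t is 1%N then 2 * c * K x else - c.
have bu b t : bounded_mfun (u b t).
  have b1 := @bounded_mfun_cst _ R R (1 : R).
  case: b; first exact: bounded_mfunX.
  case: t => -[|[|k]] ? /=; rewrite /u/=.
  - by apply/bounded_mfunB/bounded_mfunZ/bounded_mfunX.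
  - exact: bounded_mfunZ.
  - exact: bounded_mfun_cst.
have -> : E (fun w => \prod_(k < m)
      (1 - c * (Y (e (k, false)) w - Y (e (k, true)) w) ^+ 2)) =
    E (fun w => \sum_(t : {ffun 'I_m -> 'I_3})
      \prod_(q : 'I_m * bool) u q.2 (t q.1) (Y (e q) w)).
  apply: eq_Ex => w.
  transitivity (\prod_(k < m) \sum_(t : 'I_3)
      u false t (Y (e (k, false)) w) * u true t (Y (e (k, true)) w)).
    apply: eq_bigr => k _; rewrite !big_ord_recl big_ord0 /u/= !KY.
    by rewrite /bump/=; ring.
  rewrite bigA_distr_bigA/=; apply: eq_bigr => t _.
  rewrite [RHS](eq_bigr (fun q => u q.2 (t q.1) (Y (e (q.1, q.2)) w)));
    last by case.
  rewrite -(pair_bigA _ (fun k b => u b (t k) (Y (e (k, b)) w)))/=.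
  by apply: eq_bigr => k _; rewrite big_bool mulrC.
rewrite Ex_sum; last first.
  move=> t _; apply: bounded_mfun_prod => q _.
  exact: bounded_mfun_comp.
under eq_bigr => t _ do
  rewrite (@Ex_prod_inj _ e (fun q => u q.2 (t q.1)) inj_e (fun q => bu _ _)).
(* The same distributivity read backwards, now on expectations, restores a product over the
   pairs. *)
transitivity (\prod_(k < m) \sum_(t : 'I_3)
    E (fun w => u false t (W w)) * E (fun w => u true t (W w))).
  rewrite bigA_distr_bigA/=; apply: eq_bigr => t _.
  rewrite -(pair_bigA _ (fun k b => E (fun w => u b (t k) (W w))))/=.
  by apply: eq_bigr => k _; rewrite big_bool mulrC.
rewrite prodr_const card_ord; congr (_ ^+ _).
have bW2 : bounded_mfun (fun w => W w ^+ 2) by exact: bounded_mfunX.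
rewrite !big_ord_recl big_ord0 /u/= /bump/=.
have e1 : E (fun w => 1 - c * K (W w) ^+ 2) = 1 - c * E (fun w => W w ^+ 2).
  under eq_Ex do rewrite KW.
  rewrite ExB ?Ex_cst ?ExZ//; [exact: bounded_mfun_cst|exact: bounded_mfunZ].
have e2 : E (fun w => 2 * c * K (W w)) = 2 * c * p.
  by under eq_Ex do rewrite KW; rewrite ExZ.
have e3 : E (fun w => K (W w) ^+ 2) = E (fun w => W w ^+ 2).
  by apply: eq_Ex => w; rewrite KW.
have e4 : E (fun w => K (W w) ^+ 1) = p.
  by apply: eq_Ex => w; rewrite KW expr1.
rewrite e1 e2 e3 e4 !Ex_cst VE.
by ring.
Qed.

Lemma bounded_sample_var : bounded_mfun (fun w => sample_var (Y^~ w)).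
Proof.
apply/bounded_mfunZ/bounded_mfun_sum => i _; apply: bounded_mfun_sum => j _.
by apply/bounded_mfunX/bounded_mfunB.
Qed.

(* The sample variance is an average over permutations of means of n./2
   independent copies of D / 2, where D = (Y - Y')^2 satisfies D^2 <= D. *)
Lemma sample_var_mgf (r : R) : (2 <= n)%N -> 0 <= r ->
  E (fun w => expR (r * - sample_var (Y^~ w))) <=
  expR (- (r * V) + r ^+ 2 * V / (2 * (n%:R - 1))).
Proof.
move=> n2 r0.
pose m := n./2.
have m_gt0 : (0 < m)%N by rewrite half_gt0.
have lt_e (q : 'I_m * bool) : (q.2 + q.1.*2 < n)%N.
  have h : (q.1.+1.*2 <= n)%N.
    by rewrite -[leqRHS]odd_double_half (leq_trans _ (leq_addl _ _))// leq_double.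
  by apply: leq_trans h; rewrite doubleS; case: q.2.
pose e q := Ordinal (lt_e q).
have inj_e : injective e.
  move=> [k b] [k' b'] /(congr1 val)/= h; congr (_, _).
    by apply: val_inj; move: (congr1 half h); rewrite !half_bit_double.
  by move: (congr1 odd h); rewrite !oddD !odd_double !addbF !oddb.
have mR : 0 < m%:R :> R by rewrite ltr0n.
(* The [n - 1] of the bound comes from here: [n - 1 <= 2 m], with equality for odd [n], when one
   observation is left unpaired. *)
have nm : 2 * (n%:R - 1) <= 4 * m%:R :> R.
  have : (n <= m.*2.+1)%N by rewrite -[X in (X <= _)%N]odd_double_half; case: (odd n).
  by rewrite -(ler_nat R) -natr1 -mul2n natrM; lra.
have nR : 0 < 2 * (n%:R - 1) :> R.
  by have := n2; rewrite -(ler_nat R); lra.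
(* [mu] is the weight of one pair in the exponent, since each permutation contributes a mean over
   [m] pairs. *)
pose mu := r / m%:R.
have mu0 : 0 <= mu by rewrite divr_ge0// ltW.
pose c := mu / 2 - mu ^+ 2 / 8.
pose D (s : {perm 'I_n}) k w := (Y (s (e (k, false))) w - Y (s (e (k, true))) w) ^+ 2.
have D01 s k w : 0 <= D s k w <= 1.
  rewrite sqr_ge0/= /D; have := Y01 (s (e (k, false))) w.
  by have := Y01 (s (e (k, true))) w; nra.
have bD s k : bounded_mfun (D s k) by apply/bounded_mfunX/bounded_mfunB.
have b1 := bounded_mfun_cst Om (1 : R).
have bprod s : bounded_mfun (fun w => \prod_(k < m) (1 - c * D s k w)).
  by apply: bounded_mfun_prod => k _; apply/bounded_mfunB/bounded_mfunZ.
have N0 : (0 < #|{perm 'I_n}|)%N by rewrite card_Sn fact_gt0.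
have N0' : 0 < #|{perm 'I_n}|%:R :> R by rewrite ltr0n.
apply: (@le_trans _ _ (E (fun w => #|{perm 'I_n}|%:R^-1 *
    \sum_(s : {perm 'I_n}) \prod_(k < m) (1 - c * D s k w)))).
  apply: Ex_le.
  - by apply/bounded_mfun_expR/bounded_mfunZ/bounded_mfunN/bounded_sample_var.
  - exact/bounded_mfunZ/bounded_mfun_sum.
  move=> w; rewrite (sample_var_perm _ m_gt0 n2 (a := fun k => e (k, false))
    (b := fun k => e (k, true))); last by move=> k; rewrite (inj_eq inj_e) xpair_eqE andbF.
  rewrite mulrN -mulNr mulrCA mulr_sumr.
  apply: (le_trans (jensen_expR _ N0)).
  apply: ler_wpM2l; first by rewrite invr_ge0 ltW.
  apply: ler_sum => s _.
  rewrite mulrA mulNr -/mu mulNr mulr_sumr -sumrN expR_sum.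
  apply: ler_prod => k _; rewrite expR_ge0/= -/(D s k w).
  have /andP[D0 D1] := D01 s k w.
  have := @expRN_le R (mu * (D s k w / 2)) => h.
  apply: (le_trans (h _)); first by rewrite mulr_ge0// divr_ge0.
  have h1 : 0 <= 1 - D s k w by lra.
  by have := mulr_ge0 (sqr_ge0 mu) (mulr_ge0 D0 h1); rewrite /c; lra.
rewrite ExZ; last exact: bounded_mfun_sum.
rewrite Ex_sum//.
under eq_bigr => s _ do
  rewrite (@Ex_prod_pairs m (fun q => s (e q)) c (inj_comp (@perm_inj _ s) inj_e)).
rewrite sumr_const -[_ *+ #|_|]mulr_natl mulKf ?gt_eqF//.
have /andP[V0 V1] := V01.
apply: (@le_trans _ _ (expR (- (c * (2 * V))) ^+ m)).
  apply: lerXn2r; rewrite ?nnegrE ?expR_ge0//; last exact: expR_ge1Dx.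
  (* Taking [m]-th powers needs the base [1 - 2 c V] to be nonnegative: [c] is at most [1 / 2], its
     value at [mu = 2], and [V <= 1]. *)
  have c1 : c <= 1 / 2 by rewrite /c; have := sqr_ge0 (mu - 2); lra.
  by nra.
rewrite -expRM_natl ler_expR.
have -> : m%:R * - (c * (2 * V)) = - (r * V) + r ^+ 2 * V / (4 * m%:R).
  by rewrite /c /mu; field; rewrite gt_eqF.
rewrite lerD2l ler_wpM2l ?mulr_ge0 ?sqr_ge0//.
by rewrite lef_pV2 ?posrE// mulr_gt0.
Qed.

Lemma hoeffding_tail (t : R) : (0 < n)%N -> 0 <= t ->
  fine (P [set w | t < mean w - p]) <= expR (- (2 * n%:R * t ^+ 2)).
Proof.
move=> n0 t0.
(* [r = 4 t] minimizes the exponent [r^2 / 8 - r t]. *)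
have r0 : 0 <= 4 * t by rewrite mulr_ge0.
apply: (le_trans (mean_upper_tail t n0 r0 (hoeffding_mgf r0))).
rewrite -expRM_natl -expRD ler_expR le_eqVlt; apply/orP; left; apply/eqP.
by field.
Qed.

Lemma bernstein_tail (L : R) : (0 < n)%N -> 0 < V -> 0 <= L ->
  fine (P [set w | Num.sqrt (2 * V * L / n%:R) + L / (3 * n%:R) < mean w - p])
  <= expR (- L).
Proof.
move=> n0 V0 L0.
have n0' : 0 < n%:R :> R by rewrite ltr0n.
set s := Num.sqrt _.
have s0 : 0 <= s by exact: sqrtr_ge0.
have s2 : s ^+ 2 = 2 * V * L / n%:R.
  by rewrite sqr_sqrtr// divr_ge0 ?(ltW n0')// mulr_ge0// mulr_ge0// ltW.
(* Up to the factor 1 + u / 3, u = s / V is the Gaussian optimizer. *)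
pose u := s / V.
have u0 : 0 <= u by rewrite divr_ge0// ltW.
pose k := 1 + u / 3.
have k0 : 0 < k by rewrite /k; lra.
pose r := u / k.
have r03 : 0 <= r < 3.
  by rewrite /r divr_ge0 ?(ltW k0)//= ltr_pdivrMr// /k; lra.
have /andP[r0 _] := r03.
apply: (le_trans (mean_upper_tail _ n0 r0 (bernstein_mgf r03))).
rewrite -expRM_natl -expRD ler_expR le_eqVlt; apply/orP; left; apply/eqP.
have us : u * s = 2 * (L / n%:R).
  by rewrite /u mulrAC -expr2 s2; field; rewrite !gt_eqF.
have uV : u ^+ 2 * V = 2 * (L / n%:R).
  by rewrite -us /u; field; rewrite gt_eqF.
have kE : k = 1 + u / 3 by [].
have rk : 1 - r / 3 = k^-1.
  apply: (mulIf (lt0r_neq0 k0)); rewrite mulVf ?gt_eqF// mulrBl mul1r /r.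
  by rewrite mulrAC divfK ?gt_eqF// kE; lra.
(* Since [1 - r / 3 = 1 / k], all terms share the denominator [k]; the numerator is also a multiple
   of [k], so the exponent is exactly [- L]. *)
transitivity (n%:R * (u ^+ 2 * V / 2 - u * s - u * (L / n%:R) / 3) / k).
  by rewrite rk /r; field; rewrite !gt_eqF.
have -> : u ^+ 2 * V / 2 - u * s - u * (L / n%:R) / 3 = - (L / n%:R) * k.
  by rewrite uV us kE; field; rewrite gt_eqF.
by field; rewrite !gt_eqF.
Qed.

(** The optimizer of [bernstein_tail] divides by [V]. For [V = 0] the Bernstein bound on the
    generating function is 1, and [r = 1] is enough. *)
Lemma degenerate_tail (L : R) : (0 < n)%N -> V = 0 ->
  fine (P [set w | L / n%:R < mean w - p]) <= expR (- L).
Proof.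
move=> n0 V0.
have r03 : 0 <= (1 : R) < 3 by lra.
apply: (le_trans (mean_upper_tail _ n0 ler01 (bernstein_mgf r03))).
rewrite V0 mulr0 mul0r expR0 expr1n !mul1r mulrC divfK//.
by rewrite pnatr_eq0 -lt0n.
Qed.

Lemma sample_var_lower_tail (L : R) : (2 <= n)%N -> 0 < V -> 0 <= L ->
  fine (P [set w | Num.sqrt (2 * L * V / (n%:R - 1)) - V < - sample_var (Y^~ w)])
  <= expR (- L).
Proof.
move=> n2 V0 L0; set t := Num.sqrt _.
have N0 : 0 < n%:R - 1 :> R by have := n2; rewrite -(ler_nat R); lra.
have t0 : 0 <= t by exact: sqrtr_ge0.
have t2 : t ^+ 2 = 2 * L * V / (n%:R - 1).
  by rewrite sqr_sqrtr// divr_ge0 ?(ltW N0)// mulr_ge0 ?(ltW V0)// mulr_ge0.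
(* This [r] minimizes [r^2 V / (2 (n - 1)) - r t], what remains of the exponent once the terms [r V]
   cancel; the minimum is [- L]. *)
have r0 : 0 <= (n%:R - 1) * t / V by rewrite divr_ge0 ?(ltW V0)// mulr_ge0// ltW.
apply: (le_trans (chernoff_bounded _ _ r0 (sample_var_mgf n2 r0))).
  exact/bounded_mfunN/bounded_sample_var.
rewrite -expRD ler_expR le_eqVlt; apply/orP; left; apply/eqP.
transitivity (- ((n%:R - 1) * t ^+ 2 / (2 * V))).
  by field; rewrite !gt_eqF.
by rewrite t2; field; rewrite !gt_eqF.
Qed.

Lemma empirical_bernstein_tail (L : R) : (2 <= n)%N -> 0 < L ->
  fine (P [set w | Num.sqrt (2 * sample_var (Y^~ w) * L / n%:R)
                   + 7 * L / (3 * (n%:R - 1)) < mean w - p])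
  <= 2 * expR (- L).
Proof.
move=> n2 L0; have n0 : (0 < n)%N by apply: leq_trans n2.
have n0' : 0 < n%:R :> R by rewrite ltr0n.
have N0 : 0 < n%:R - 1 :> R by have := n2; rewrite -(ler_nat R); lra.
have bm : bounded_mfun (fun w => mean w - p).
  apply: bounded_mfunB; last exact: bounded_mfun_cst.
  by apply: bounded_mfunZ; exact: bounded_mfun_sum.
have msv := bounded_sample_var.1.
set A := [set w | _].
have mA : measurable A.
  by apply: measurable_lt_set bm.1; exact: measurable_empirical_bound.
have mlt (f : Om -> R) (a : R) : measurable_fun setT f -> measurable [set w | a < f w].
  by move=> mf; apply: (measurable_lt_set (measurable_cst a) mf).
have /andP[V0 _] := V01.
(* If [V = 0], a single event suffices, as [L / n <= 7 L / (3 (n - 1))]. *)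
move: V0; rewrite le_eqVlt => /predU1P[/esym V0|V0].
  apply: (@le_trans _ _ (expR (- L))); last by have := expR_ge0 (- L); lra.
  apply: le_trans (degenerate_tail L n0 V0).
  set B0 := [set w | L / n%:R < mean w - p].
  have mB0 : measurable B0 by exact: mlt bm.1.
  rewrite fine_le ?fin_num_measure//; apply: le_measure; rewrite ?inE// => w.
  rewrite /A/B0/=; apply: le_lt_trans.
  rewrite ler_wpDl ?sqrtr_ge0// ler_pdivrMr// mulrAC ler_pdivlMr; nra.
have L0' := ltW L0.
set B1 := [set w | Num.sqrt (2 * V * L / n%:R) + L / (3 * n%:R) < mean w - p].
set B2 := [set w | Num.sqrt (2 * L * V / (n%:R - 1)) - V < - sample_var (Y^~ w)].
have mB1 : measurable B1 by exact: mlt bm.1.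
have mB2 : measurable B2 by apply: mlt; exact: measurable_funN.
have h := lerD (bernstein_tail n0 V0 L0') (sample_var_lower_tail n2 V0 L0').
rewrite mulr_natl mulr2n; apply: le_trans h.
(* Union bound on indicators: outside [B1] and [B2], [empirical_bernstein_width] with [N = n - 1]
   excludes [A]. *)
rewrite -!Ex_indic// -ExD; try exact: bounded_mfun_indic.
apply: Ex_le; first exact: bounded_mfun_indic.
  by apply: bounded_mfunD; exact: bounded_mfun_indic.
move=> w; rewrite !indicE.
have [|_] := boolP (w \in A); last by rewrite addr_ge0.
rewrite inE /A/= => Aw.
have [|B1w] := boolP (w \in B1); first by rewrite lerDl.
have [|B2w] := boolP (w \in B2); first by rewrite lerDr.
exfalso; move: Aw; apply/negP; rewrite -leNgt.
move: B1w B2w; rewrite !notin_setE /B1 /B2/= => /negP + /negP.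
rewrite -!leNgt => B1w B2w.
apply: (le_trans B1w); apply: empirical_bernstein_width => //.
- by lra.
- rewrite mulr_ge0 ?invr_ge0 ?mulr_ge0 ?(ltW N0)//.
  by apply: sumr_ge0 => i _; apply: sumr_ge0 => j _; exact: sqr_ge0.
- by lra.
Qed.

End Sample.

(** * The bounds for the training error *)

(** A product of indicators is the indicator of an intersection, so independence is used on the full
    index set with the preimages of the [A i] under [phi]. *)
Lemma mutually_independent_indic (dO : measure_display) (Om : measurableType dO)
    (R : realType) (P : probability Om R) (I : finType)
    (d1 : measure_display) (T1 : measurableType d1) (Y : I -> Om -> T1)
    (phi : T1 -> R) :
  (forall i, measurable_fun setT (Y i)) -> measurable_fun setT phi ->
  mutually_independent P Y -> indic_independent P (fun i w => phi (Y i w)).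
Proof.
move=> mY mphi indep A mA.
pose B i := phi @^-1` A i.
have mB i : measurable (B i).
  by rewrite -[B i]setTI; apply: mphi.
have mYB i : measurable (Y i @^-1` B i).
  by rewrite -[Y i @^-1` B i]setTI; apply: mY.
have indicE' i w : \1_(A i) (phi (Y i w)) = \1_(Y i @^-1` B i) w :> R.
  by rewrite !indicE; congr (nat_of_bool _)%:R; apply/idP/idP; rewrite !in_setE.
have /(congr1 fine) := indep [set: I]%SET B (fun i _ => mB i).
set C := \bigcap_(i in _) _.
have mC : measurable C.
  by apply: fin_bigcap_measurable => //; exact: finite_finset.
rewrite -Ex_indic//.
rewrite (eq_bigr (fun i => (fine (P (Y i @^-1` B i)))%:E)); last first.
  by move=> i _; rewrite fine_probK.
rewrite prodEFin/= => h.
transitivity (Ex P (fun w => \1_C w)).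
  apply: eq_Ex => w; rewrite (eq_bigr _ (fun i _ => indicE' i w)).
  rewrite indicE; have [|] := boolP (w \in C).
    rewrite in_setE => Cw; apply: big1 => i _; rewrite indicE mem_set//.
    by apply: Cw => /=; rewrite inE.
  rewrite notin_setE => nCw; apply/eqP/prodf_eq0.
  move/existsNP : nCw => [i /not_implyP[_ nBi]].
  by exists i => //; rewrite indicE memNset.
rewrite h; under [RHS]eq_bigr do under eq_Ex do rewrite indicE'.
by apply: eq_big => [i|i _]; rewrite ?inE// Ex_indic.
Qed.

Lemma measurable_noisy (dO : measure_display) (Om : measurableType dO)
    (R : realType) (k : nat) (X Z : Om -> k.-tuple R) (sigma : R) :
  measurable_fun setT X -> measurable_fun setT Z ->
  measurable_fun setT (noisy X sigma Z).
Proof.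
move=> mX mZ; apply/measurable_fun_tnthP => i.
have -> : (@tnth k R)^~ i \o noisy X sigma Z =
    (fun w => tnth (X w) i + sigma * tnth (Z w) i).
  by apply/funext => w /=; rewrite tnth_mktuple.
apply: measurable_funD; last apply: measurable_funM => //.
- exact: (measurableT_comp (measurable_tnth i) mX).
- exact: (measurableT_comp (measurable_tnth i) mZ).
Qed.

(** Pointwise [\1_A] is at most [\1_B] plus the indicators of the null sets, whose expectations
    vanish. *)
Lemma fine_prob_le_null (dO : measure_display) (Om : measurableType dO)
    (R : realType) (P : probability Om R) (I : finType) (A B : set Om)
    (N : I -> set Om) :
  measurable A -> measurable B -> (forall i, measurable (N i)) ->
  (forall i, fine (P (N i)) = 0) ->
  (forall w, A w -> B w \/ exists i, N i w) -> fine (P A) <= fine (P B).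
Proof.
move=> mA mB mN PN AB.
have bN i : bounded_mfun (fun w => \1_(N i) w : R) by exact: bounded_mfun_indic.
have -> : fine (P B) = Ex P (fun w => \1_B w + \sum_i \1_(N i) w).
  rewrite ExD; [|exact: bounded_mfun_indic|exact: bounded_mfun_sum].
  rewrite Ex_sum// Ex_indic// big1 ?addr0// => i _.
  by rewrite Ex_indic.
rewrite -Ex_indic//; apply: Ex_le; first exact: bounded_mfun_indic.
  by apply: bounded_mfunD; [exact: bounded_mfun_indic | exact: bounded_mfun_sum].
move=> w; rewrite [leLHS]indicE; case: (boolP (w \in A)) => [|_]; last first.
  by rewrite addr_ge0// sumr_ge0.
rewrite in_setE => /AB[Bw|[i Niw]].
  by rewrite indicE mem_set// lerDl sumr_ge0.
by rewrite (bigD1 i)//= [\1_(N i) w]indicE (mem_set Niw) addrCA lerDl addr_ge0// sumr_ge0.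
Qed.

Lemma prob_le_of_tail (dO : measure_display) (Om : measurableType dO)
    (R : realType) (P : probability Om R) (f g : Om -> R) (delta : R) :
  measurable_fun setT f -> measurable_fun setT g ->
  fine (P [set w | g w < f w]) <= delta ->
  ((1 - delta)%:E <= P [set w | (f w <= g w)%R])%E.
Proof.
move=> mf mg tail; have mB := measurable_lt_set mg mf.
have -> : [set w | f w <= g w] = ~` [set w | g w < f w].
  by apply/seteqP; split=> w /=; [rewrite leNgt => /negP | move/negP; rewrite -leNgt].
by rewrite probability_setC// -fine_probK// -EFinB lee_fin lerD2l lerN2.
Qed.

Theorem proposition1 (R : realType) (dO : measure_display)
  (Om : measurableType dO) (P : probability Om R)
  (d : nat) (hd : (1 <= d)%N)
  (X : {RV P >-> d.-tuple R}) (S : {RV P >-> R})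
  (hS : forall w, 0 <= S w <= 1)
  (sigma : R) (hsigma : 0 < sigma)
  (Z : {RV P >-> d.-tuple R}) (hZ : standard_gaussian P Z)
  (hZXS : independent2 P Z (fun w => (X w, S w)))
  (n : nat) (hn : (1 <= n)%N)
  (Xs : 'I_n -> {RV P >-> d.-tuple R}) (Ss : 'I_n -> {RV P >-> R})
  (hindep : mutually_independent P (fun i w => (Xs i w, Ss i w)))
  (hlaw : forall i, same_law P (fun w => (Xs i w, Ss i w))
                               (fun w => (noisy X sigma Z w, S w)))
  (H : set (d.-tuple R -> R))
  (hHmeas : forall h, H h -> measurable_fun setT h)
  (hH01 : forall h, H h -> forall x, 0 <= h x <= 1)
  (hstar : d.-tuple R -> R)
  (hmin : is_minimizer P H (noisy X sigma Z) S hstar)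
  (delta : R) (hdelta : 0 < delta < 1) :
  let epsC w := mse_train Xs Ss hstar w - MMSE P H (noisy X sigma Z) S in
  let W w i := sq_err (Xs i) (Ss i) hstar w in
  let boundI := Num.sqrt (ln (1 / delta) / (2 * n%:R)) in
  let boundII w :=
    Num.sqrt (2 * sample_var (W w) * ln (2 / delta) / n%:R)
    + 7 * ln (2 / delta) / (3 * (n%:R - 1)) in
  ((1 - delta)%:E <= P [set w | (epsC w <= boundI)%R])%E /\
  ((2 <= n)%N -> ((1 - delta)%:E <= P [set w | (epsC w <= boundII w)%R])%E).
Proof.
move=> epsC W boundI boundII.
have [Hstar hstar_min] := hmin.
have mstar := hHmeas _ Hstar.
have h01 := hH01 _ Hstar.
have /andP[delta0 delta1] := hdelta.
pose clamp (s : R) : R := Num.max 0 (Num.min s 1).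
have clamp01 s : 0 <= clamp s <= 1.
  by rewrite /clamp le_max lexx/= ge_max ler01 ge_min lexx orbT.
have clamp_id s : 0 <= s <= 1 -> clamp s = s.
  by move=> /andP[s0 s1]; rewrite /clamp min_l// max_r.
have mclamp : measurable_fun setT clamp.
  by apply: measurable_maxr => //; apply: measurable_minr.
(* The samples Ss i lie in [0, 1] only almost surely, whereas the tail bounds
   are applied to variables that lie in [0, 1] everywhere. *)
pose phi (xs : d.-tuple R * R) : R := (clamp xs.2 - hstar xs.1) ^+ 2.
have mphi : measurable_fun setT phi.
  apply: measurable_funX; apply: measurable_funB.
    exact: (measurableT_comp mclamp measurable_snd).
  exact: (measurableT_comp mstar measurable_fst).
have phi01 xs : 0 <= phi xs <= 1.
  by rewrite sqr_ge0/= /phi; have := h01 xs.1; have := clamp01 xs.2; nra.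
pose W0 w := phi (noisy X sigma Z w, S w).
pose Y i w := phi (Xs i w, Ss i w).
have mnoisy : measurable_fun setT (noisy X sigma Z) by exact: measurable_noisy.
have mpair : measurable_fun setT (fun w => (noisy X sigma Z w, S w)).
  exact: measurable_fun_pair.
have mpairs i : measurable_fun setT (fun w => (Xs i w, Ss i w)).
  exact: measurable_fun_pair.
have mW0 : measurable_fun setT W0 by exact: measurableT_comp mphi mpair.
have mY i : measurable_fun setT (Y i) by exact: measurableT_comp mphi (mpairs i).
have W01 w : 0 <= W0 w <= 1 by exact: phi01.
have Y01 i w : 0 <= Y i w <= 1 by exact: phi01.
have Y_indep : indic_independent P Y.
  exact: (mutually_independent_indic mpairs mphi hindep).
have Y_law i A : measurable A ->
    Ex P (fun w => \1_A (Y i w)) = Ex P (fun w => \1_A (W0 w)).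
  move=> mA.
  have mphiA : measurable (phi @^-1` A).
    by rewrite -[_ @^-1` _]setTI; exact: mphi.
  have /(congr1 fine) := hlaw i _ mphiA.
  rewrite /pushforward -!Ex_indic; first exact.
    by rewrite -[X in measurable X]setTI; exact: mpair.
  by rewrite -[X in measurable X]setTI; exact: mpairs.
(* The infimum is attained at [hstar], and clamping is invisible because [S] lies in [0, 1]
   everywhere. *)
have MMSE_E : MMSE P H (noisy X sigma Z) S = Ex P W0.
  transitivity (fine (mse P (noisy X sigma Z) S hstar)).
    congr fine; apply/eqP; rewrite eq_le; apply/andP; split.
      by apply: ereal_inf_lbound; exists hstar.
    by apply: le_ereal_inf_tmp => _ [g Hg <-]; exact: hstar_min.
  rewrite /mse unlock; apply: eq_Ex => w.
  by rewrite /sq_err /W0 /phi/= clamp_id.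
pose N i := [set w | ~~ (0 <= Ss i w <= 1)].
have mN01 : measurable (~` `[0, 1]%classic : set R).
  by apply: measurableC; exact: measurable_itv.
have mN i : measurable (N i).
  have -> : N i = Ss i @^-1` (~` `[0, 1]%classic).
    by apply/seteqP; split=> w /=; rewrite in_itv/= => /negP.
  by rewrite -[_ @^-1` _]setTI; exact: measurable_funP.
(* Equality of laws is tested on pairs whose second coordinate leaves [0, 1], an event that is empty
   for [S]. *)
have PN i : fine (P (N i)) = 0.
  have := hlaw i _ (measurableX measurableT mN01); rewrite /pushforward.
  set A1 := _ @^-1` _; set A2 := _ @^-1` _.
  have -> : A1 = N i.
    apply/seteqP; split=> w; rewrite /A1/= in_itv/=; first by case=> _ /negP.
    by move=> /negP.
  have -> : A2 = set0.
    by apply/seteqP; split=> w //; rewrite /A2/= in_itv/= hS => -[].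
  by move=> ->; rewrite measure0.
have W_eq w : (forall i, ~ N i w) -> W w = Y^~ w.
  move=> NNw; apply/funext => i; rewrite /W /Y /phi /sq_err/= clamp_id//.
  by apply/negPn/negP; exact: NNw.
have epsE w : epsC w = n%:R^-1 * \sum_(i < n) W w i - Ex P W0.
  by rewrite /epsC MMSE_E.
have mW i : measurable_fun setT (fun w => W w i).
  apply: measurable_funX; apply: measurable_funB => //.
  exact: measurableT_comp mstar _.
have meps : measurable_fun setT epsC.
  rewrite (funext epsE); apply: measurable_funB => //.
  by apply: measurable_funM => //; exact: measurable_sum.
have ln_gt0 (a : R) : 1 <= a -> 0 < ln (a / delta).
  by move=> a1; rewrite ln_gt0// ltr_pdivlMr// mul1r (lt_le_trans delta1).
have expRN_ln (a : R) : 1 <= a -> a * expR (- ln (a / delta)) = delta.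
  move=> a1; have a0 : 0 < a by lra.
  by rewrite expRN lnK ?posrE ?divr_gt0//; field; rewrite !gt_eqF.
(* [g] is the bound as a function of the vector of losses, so that [W] can be exchanged for the
   clamped [Y] on both sides, off the null sets [N i]. *)
have transfer (g : ('I_n -> R) -> R) (c : R) :
    measurable_fun setT (fun w => g (W w)) -> measurable_fun setT (fun w => g (Y^~ w)) ->
    fine (P [set w | g (Y^~ w) < n%:R^-1 * \sum_(i < n) Y i w - Ex P W0]) <= c ->
    fine (P [set w | g (W w) < epsC w]) <= c.
  move=> mg mg'; apply: le_trans.
  apply: (fine_prob_le_null (N := N)) => //.
  - exact: measurable_lt_set.
  - apply: measurable_lt_set => //; apply: measurable_funB => //.
    by apply: measurable_funM => //; exact: measurable_sum.
  - move=> w /= gw; have [NNw|] := pselect (forall i, ~ N i w).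
      by left; move: gw; rewrite epsE W_eq.
    by move=> /existsNP[i /contrapT Niw]; right; exists i.
split=> [|n2]; apply: prob_le_of_tail => //.
- apply: (transfer (fun=> boundI)) => //.
  have t0 : 0 <= boundI by exact: sqrtr_ge0.
  apply: (le_trans (hoeffding_tail mW0 W01 mY Y01 Y_indep Y_law hn t0)).
  rewrite sqr_sqrtr; last first.
    by rewrite divr_ge0 ?mulr_ge0 ?ler0n// ltW// ln_gt0.
  rewrite -[leRHS](expRN_ln 1)// -[leLHS]mul1r ler_pM2l// ler_expR lerN2.
  rewrite [leRHS]mulrC divfK//.
  by rewrite mulf_neq0// pnatr_eq0 -lt0n.
- exact: measurable_empirical_bound.
- pose g (v : 'I_n -> R) := Num.sqrt (2 * sample_var v * ln (2 / delta) / n%:R)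
    + 7 * ln (2 / delta) / (3 * (n%:R - 1)).
  apply: (transfer g); [exact: measurable_empirical_bound|exact: measurable_empirical_bound|].
  apply: (le_trans (empirical_bernstein_tail mW0 W01 mY Y01 Y_indep Y_law n2 _)).
    by apply: ln_gt0; lra.
  (* The 2 in [ln (2 / delta)] pays for the two exceptional events, [delta / 2] each. *)
  by rewrite expRN_ln//; lra.
Qed.
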